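(* Let $T$ be a set of positive existential sentences over a relational signature. The following are equivalent: (1) $T$ is the positive existential theory of a countable weakly oligomorphic structure; (2) $T$ is the positive existential part of an $\omega$-categorical theory; (3) $T$ is the positive existential theory of a countable oligomorphic structure.
   Context: Relational signatures have only relation symbols; ''countable'' means finite or countably infinite. The positive existential theory of a structure is the set of all positive existential first-order sentences true in it; the positive existential part of a theory is the set of its positive existential sentences. A positive existential type in $x_1,\dots,x_n$ is a set of positive existential formulas with free variables among $x_1,\dots,x_n$, defining the intersection of the relations defined by its members; a structure is weakly oligomorphic if for each $n$ only finitely many $n$-ary relations are definable by such types; oligomorphic if its automorphism group has finitely many orbits on $n$-tuples for each $n$. A first-order theory is $\omega$-categorical if it has, up to isomorphism, exactly one countably infinite model.
   Formalization: (2) implies (1),(3) is stated only for countable signatures (it fails for the natural numbers with all finitary relations); all other implications hold for any signature. The theory in (2) is taken complete and deductively closed, without which (2) does not imply (3); structures are nonempty. *)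

(* Defs.v *)
From mathcomp Require Import all_boot.
From mathcomp Require Import boolp classical_sets functions cardinality.

Set Implicit Arguments.
Unset Strict Implicit.
Unset Printing Implicit Defensive.

Local Open Scope classical_set_scope.

Record signature := Signature { symbol :> Type; arity : symbol -> nat }.

(* Structures are nonempty. The positive existential theory of an empty         *)
(* structure omits [exists x, x = x], which holds in every infinite structure.  *)
Record structure (S : signature) := Structure {
  dom :> Type;
  interp : forall R : S, (arity R).-tuple dom -> Prop;
  dom_inhabited : inhabited dom }.

(* [formula S n]: first-order formulas with equality whose free variables are   *)
(* among n given ones, indexed by 'I_n. In the body of a quantifier the bound   *)
(* variable has index 0 and the indices of the others are shifted by one.       *)
Inductive formula (S : signature) : nat -> Type :=
| fEq n of 'I_n & 'I_n : formula S n
| fRel n (R : S) of (arity R).-tuple 'I_n : formula S n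
| fNot n of formula S n : formula S n
| fAnd n of formula S n & formula S n : formula S n
| fOr n of formula S n & formula S n : formula S n
| fEx n of formula S n.+1 : formula S n
| fAll n of formula S n.+1 : formula S n.

Definition sentence (S : signature) : Type := formula S 0.

Fixpoint sat (S : signature) (M : structure S) (n : nat) (phi : formula S n) :
    n.-tuple M -> Prop :=
  match phi in formula _ n return n.-tuple M -> Prop with
  | fEq _ i j => fun e => tnth e i = tnth e j
  | fRel _ R v => fun e => interp [tuple of map (tnth e) v]
  | fNot _ f => fun e => ~ sat f e
  | fAnd _ f g => fun e => sat f e /\ sat g e
  | fOr _ f g => fun e => sat f e \/ sat g e
  | fEx _ f => fun e => exists x : M, sat f [tuple of x :: e]
  | fAll _ f => fun e => forall x : M, sat f [tuple of x :: e]
  end.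

Definition holds (S : signature) (M : structure S) (phi : sentence S) : Prop :=
  sat phi [tuple of [::] : seq M].

Definition model (S : signature) (Th : set (sentence S)) (M : structure S) :
    Prop :=
  forall phi, Th phi -> holds M phi.

Fixpoint positive_existential (S : signature) (n : nat) (phi : formula S n) :
    bool :=
  match phi with
  | fEq _ _ _ | fRel _ _ _ => true
  | fAnd _ f g | fOr _ f g => positive_existential f && positive_existential g
  | fEx _ f => positive_existential f
  | fNot _ _ | fAll _ _ => false
  end.

Definition pe_theory (S : signature) (M : structure S) : set (sentence S) :=
  [set phi | positive_existential phi /\ holds M phi].

Definition pe_part (S : signature) (Th : set (sentence S)) :
    set (sentence S) :=
  [set phi | positive_existential phi /\ Th phi].

Definition pe_type (S : signature) (n : nat) (p : set (formula S n)) : Prop :=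
  forall phi, p phi -> positive_existential phi.

Definition type_relation (S : signature) (M : structure S) (n : nat)
    (p : set (formula S n)) : set (n.-tuple M) :=
  [set e | forall phi, p phi -> sat phi e].
Arguments type_relation {S} M {n} p.

Definition weakly_oligomorphic (S : signature) (M : structure S) : Prop :=
  forall n : nat,
    finite_set [set X : set (n.-tuple M) |
                 exists2 p : set (formula S n),
                   pe_type p & X = type_relation M p].

Definition isomorphism (S : signature) (M N : structure S) (f : M -> N) :
    Prop :=
  bijective f /\
  forall (R : S) (t : (arity R).-tuple M),
    interp t <-> interp [tuple of map f t].

Definition isomorphic (S : signature) (M N : structure S) : Prop :=
  exists f : M -> N, isomorphism f.

Definition aut_orbit (S : signature) (M : structure S) (n : nat)
    (e : n.-tuple M) : set (n.-tuple M) :=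
  [set e' | exists2 g : M -> M, isomorphism g & e' = [tuple of map g e]].

Definition oligomorphic (S : signature) (M : structure S) : Prop :=
  forall n : nat, finite_set (range (@aut_orbit S M n)).

Definition countably_infinite (T : Type) : Prop :=
  ([set: T] #= [set: nat])%card.

Definition omega_categorical (S : signature) (Th : set (sentence S)) : Prop :=
  exists M : structure S,
    [/\ countably_infinite M, model Th M &
        forall N : structure S,
          countably_infinite N -> model Th N -> isomorphic M N].

(* [omega_categorical] says nothing about finite models, so without             *)
(* completeness the positive existential part of Th could contain a disjunction *)
(* of sentences neither of which it contains, as no [pe_theory M] does.         *)
Definition complete_theory (S : signature) (Th : set (sentence S)) : Prop :=
  (forall phi : sentence S,
     (forall M : structure S, model Th M -> holds M phi) -> Th phi) /\
  (forall phi : sentence S, Th phi \/ Th (fNot phi)).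

Definition is_pe_theory_of_weakly_oligomorphic (S : signature)
    (T : set (sentence S)) : Prop :=
  exists M : structure S,
    [/\ countable [set: M], weakly_oligomorphic M & T = pe_theory M].

Definition is_pe_part_of_omega_categorical (S : signature)
    (T : set (sentence S)) : Prop :=
  exists Th : set (sentence S),
    [/\ complete_theory Th, omega_categorical Th & T = pe_part Th].

Definition is_pe_theory_of_oligomorphic (S : signature)
    (T : set (sentence S)) : Prop :=
  exists M : structure S,
    [/\ countable [set: M], oligomorphic M & T = pe_theory M].

(* Main.v *)
(* Call a tuple isolated, for a class Q of formulas, if some Q-formula true of it    *)
(* forces its whole Q-type. If isolated tuples are dense in a countable M, then M    *)
(* contains a substructure all of whose tuples are isolated in M and in which Q-     *)
(* formulas keep their meaning, and in such a structure equality of Q-types is a     *)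
(* back-and-forth system.                                                            *)
(*   (1) => (3): in a weakly oligomorphic M there are finitely many positive         *)
(* existential types in each arity, so every tuple lies below one of maximal type,   *)
(* and for positive existential Q the tuples of maximal type are the isolated ones.  *)
(* The resulting substructure is oligomorphic, with the same positive existential    *)
(* theory as M.                                                                      *)
(*   (3) => (2): M x nat, with relations pulled back along the projection, is        *)
(* infinite, oligomorphic and homomorphically equivalent to M.                       *)
(*   (2) => (3): let M be the countably infinite model. By an ultrapower and         *)
(* Loewenheim-Skolem, M realizes every decreasing sequence of satisfiable formulas.  *)
(* If isolated tuples (for all formulas) were not dense, such a sequence could avoid *)
(* all tuples of M; so they are dense, M is isomorphic to its atomic substructure,   *)
(* and the same diagonal argument shows that M has finitely many types.              *)

From Stdlib Require List.
Require Import Defs.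
From mathcomp Require Import all_boot.
From mathcomp Require Import boolp classical_sets functions cardinality filter.

Set Implicit Arguments.
Unset Strict Implicit.
Unset Printing Implicit Defensive.

Local Open Scope classical_set_scope.

(** Condition (3) is the hub. The engine is relative to a fragment [Q], taken once as the positive
    existential formulas and once as all formulas. From density of isolated tuples [atomic_submodel]
    builds a substructure of isolated tuples that passes the Tarski-Vaught test for [Q];
    [atomic_oligomorphic] turns finitely many [Q]-types of isolated tuples into finitely many
    orbits. Density comes from finiteness of the set of types in [isolated_dense] and from
    categoricity in [isolated_tuples_dense]. That (3) gives (1) is
    [oligomorphic_weakly_oligomorphic]: type-definable relations are unions of orbits. For (3) to
    (2), [finitely_many_types_isomorphic] recovers the blowup of the structure from its complete
    theory. The passage from (2) to (3) uses a countable signature for Loewenheim-Skolem and for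
    counting formulas. *)

(** * Countability, generic chains, finite families of representatives *)

Lemma countable_injection (T : Type) :
  countable [set: T] <-> exists f : T -> nat, injective f.
Proof.
split=> [/countable_injP[f f_inj]|[f f_inj]].
  by exists f => x y; apply: f_inj; rewrite in_setT.
by apply/countable_injP; exists f => x y _ _; exact: f_inj.
Qed.

Lemma countable_enumeration (T : Type) (A : set T) (x0 : T) :
  countable A -> A x0 ->
  exists u : nat -> T, (forall k, A (u k)) /\ forall x, A x -> exists k, u k = x.
Proof.
move=> /countable_injP[f f_inj] Ax0.
pose g k := if pselect (exists2 x, A x & f x = k) is left h then s2val (cid2 h) else x0.
exists g; split=> [k|x Ax].
  by rewrite /g; case: pselect => // h; case: (cid2 h).
exists (f x); rewrite /g; case: pselect => [h|[]]; last by exists x.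
by case: (cid2 h) => y Ay /= fyx; apply: f_inj; rewrite ?inE.
Qed.

(** A requirement of a construction may become meaningful only at a late stage, once its parameters
    have been chosen, so each one has to recur beyond every bound. *)
Lemma countable_enumeration_infinitely_often (T : Type) (x0 : T) :
  countable [set: T] ->
  exists u : nat -> T, forall x i, exists2 k, i <= k & u k = x.
Proof.
move=> /(countable_enumeration (x0 := x0))-/(_ I)[u [_ u_onto]].
have /(countable_enumeration (x0 := (0, 0)))-/(_ I)[v [_ v_onto]] :
  countable [set: nat * nat] by [].
exists (fun k => u (v k).1) => x i.
have [a <-] := u_onto x I.
have [w vw] := choice (fun j => v_onto (a, j) I).
have w_inj : injective w by move=> j j' /(congr1 v); rewrite !vw => -[].
(* An injective sequence of natural numbers is unbounded. *)
have [j ij] : exists j, i <= w j.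
  apply: contrapT => /forallNP w_small.
  have w_lt j : w j < i by rewrite ltnNge; apply/negP/w_small.
  pose h (j : 'I_i.+1) : 'I_i := Ordinal (w_lt j).
  have /leq_card : injective h by move=> j j' /(congr1 val)/= /w_inj/val_inj.
  by rewrite !card_ord ltnn.
by exists (w j); rewrite // vw.
Qed.

(** The bookkeeping shared by back-and-forth and by the atomic substructure: [P] is the set of
    conditions, [D k] the requirement with index [k], and every requirement is met at arbitrarily
    late stages. *)
Lemma generic_chain (X K : Type) (P : seq X -> Prop) (D : K -> seq X -> X -> Prop)
    (k0 : K) (s0 : seq X) :
  countable [set: K] -> P s0 ->
  (forall k s, P s -> exists2 x, P (x :: s) & D k s x) ->
  exists c : nat -> seq X,
    [/\ c 0 = s0, forall j, P (c j),
        forall i j x, i <= j -> List.In x (c i) -> List.In x (c j) &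
        forall k i, exists j x, [/\ i <= j, c j.+1 = x :: c j & D k (c j) x]].
Proof.
move=> /(countable_enumeration_infinitely_often k0)[u u_onto] Ps0 step.
have [next nextP] : exists next : K -> seq X -> X, forall k s, P s ->
    P (next k s :: s) /\ D k s (next k s).
  have /choice[f fP] (ks : K * seq X) : exists x, P ks.2 ->
      P (x :: ks.2) /\ D ks.1 ks.2 x.
    case: (pselect (P ks.2)) => [/(step ks.1)[x Px Dx]|nP]; first by exists x.
    by have [x _ _] := step k0 s0 Ps0; exists x.
  by exists (fun k s => f (k, s)) => k s; exact: (fP (k, s)).
pose c := fix c j := if j is i.+1 then next (u i) (c i) :: c i else s0.
have Pc j : P (c j) by elim: j => // j IHj; exact: (nextP _ _ IHj).1.
exists c; split=> // [i j x|k i].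
  elim: j => [|j IHj]; first by rewrite leqn0 => /eqP->.
  by rewrite leq_eqVlt => /predU1P[-> //|]; rewrite ltnS => /IHj h /h; right.
have [j ij uj] := u_onto k i; exists j, (next (u j) (c j)); split=> //.
by rewrite uj; apply: (nextP _ _ (Pc j)).2.
Qed.

Lemma finite_range_representatives (T U : Type) (F : T -> U) :
  finite_set (range F) -> exists m (r : 'I_m -> T), forall x, exists j, F x = F (r j).
Proof.
(* Gives [U] a choice structure, so that [finite_seqP] applies. *)
elim/Pchoice: U => U in F *.
move=> /finite_seqP[s sE].
have r_ex (j : 'I_(size s)) : exists x, F x = tnth (in_tuple s) j.
  have : range F (tnth (in_tuple s) j) by rewrite sE /= mem_tnth.
  by case=> x _ <-; exists x.
have [r rP] := choice r_ex; exists (size s), r => x.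
have : range F (F x) by exists x.
by rewrite sE => /(tnthP (in_tuple s))[j ->]; exists j; rewrite rP.
Qed.

Lemma finite_range_of_representatives (T U : Type) (F : T -> U) m (r : 'I_m -> T) :
  (forall x, exists j, F x = F (r j)) -> finite_set (range F).
Proof.
move=> rP; suff -> : range F = (F \o r) @` [set: 'I_m].
  exact/finite_image/finite_finset.
apply/seteqP; split=> [_ [x _ <-]|_ [j _ <-]]; last by exists (r j).
by have [j ->] := rP x; exists j.
Qed.

Lemma in_tnth (T : Type) (x : T) n (e : n.-tuple T) :
  List.In x e <-> exists i, tnth e i = x.
Proof.
split=> [|[i <-]].
  elim: n e => [|n IHn] e; first by rewrite tuple0.
  case/tupleP: e => y e /= [->|/IHn[i <-]]; first by exists ord0; rewrite tnth0.
  by exists (lift ord0 i); rewrite tnthS.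
elim: n e i => [|n IHn] e; first by case.
case/tupleP: e => y e i; case: (unliftP ord0 i) => [j ->|->].
  by rewrite tnthS; right; exact: IHn.
by rewrite tnth0; left.
Qed.

(** * Reindexing, renaming, fragments *)

Definition subtuple (T : Type) m n (f : 'I_m -> 'I_n) (e : n.-tuple T) : m.-tuple T :=
  [tuple tnth e (f i) | i < m].

Definition up m n (f : 'I_m -> 'I_n) (i : 'I_m.+1) : 'I_n.+1 :=
  if unlift ord0 i is Some j then lift ord0 (f j) else ord0.

Lemma subtuple_up (T : Type) m n (f : 'I_m -> 'I_n) (x : T) (e : n.-tuple T) :
  subtuple (up f) [tuple of x :: e] = [tuple of x :: subtuple f e].
Proof.
apply: eq_from_tnth => i; rewrite tnth_mktuple /up.
by case: unliftP => [j|] ->; rewrite ?tnthS ?tnth0 ?tnth_mktuple.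
Qed.

Lemma subtuple_lift0 (T : Type) n (x : T) (e : n.-tuple T) :
  subtuple (lift ord0) [tuple of x :: e] = e.
Proof. by apply: eq_from_tnth => i; rewrite tnth_mktuple tnthS. Qed.

Lemma map_subtuple (T U : Type) (h : T -> U) m n (f : 'I_m -> 'I_n) (e : n.-tuple T) :
  [tuple of map h (subtuple f e)] = subtuple f [tuple of map h e].
Proof. by apply: eq_from_tnth => i; rewrite !(tnth_map, tnth_mktuple). Qed.

Lemma map_tnth (T : Type) m n (v : m.-tuple 'I_n) (e : n.-tuple T) :
  [tuple of map (tnth e) v] = subtuple (tnth v) e.
Proof. by apply: eq_from_tnth => i; rewrite tnth_map tnth_mktuple. Qed.

Lemma map_tuple_cons (T U : Type) (h : T -> U) n x (e : n.-tuple T) :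
  [tuple of map h [tuple of x :: e]] = [tuple of h x :: [tuple of map h e]].
Proof. exact: val_inj. Qed.

Lemma subset_subtuple (T : Type) n m (t : n.-tuple T) (s : m.-tuple T) :
  (forall i, List.In (tnth t i) s) -> exists f, t = subtuple f s.
Proof.
move=> ts; have [f fP] := choice (fun i => (in_tnth _ _).1 (ts i)).
by exists f; apply: eq_from_tnth => i; rewrite tnth_mktuple fP.
Qed.

Fixpoint rename (S : signature) n (phi : formula S n) :
    forall m, ('I_n -> 'I_m) -> formula S m :=
  match phi in formula _ n return forall m, ('I_n -> 'I_m) -> formula S m with
  | fEq _ i j => fun m f => fEq S (f i) (f j)
  | fRel _ R v => fun m f => fRel [tuple of map f v]
  | fNot _ a => fun m f => fNot (rename a f)
  | fAnd _ a b => fun m f => fAnd (rename a f) (rename b f)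
  | fOr _ a b => fun m f => fOr (rename a f) (rename b f)
  | fEx _ a => fun m f => fEx (rename a (up f))
  | fAll _ a => fun m f => fAll (rename a (up f))
  end.

Lemma sat_rename (S : signature) (M : structure S) n (phi : formula S n) m
    (f : 'I_n -> 'I_m) (e : m.-tuple M) :
  sat (rename phi f) e <-> sat phi (subtuple f e).
Proof.
elim: phi m f e => {n} /= [n i j|n R v|n a IHa|n a IHa b IHb|n a IHa b IHb|n a IHa|n a IHa] m f e.
- by rewrite !tnth_mktuple.
- suff -> : [tuple of map (tnth e) [tuple of map f v]] =
           [tuple of map (tnth (subtuple f e)) v] by [].
  by apply: eq_from_tnth => i; rewrite !tnth_map tnth_ord_tuple.
- by split=> na /IHa.
- by split=> -[/IHa ? /IHb ?].
- by split=> -[/IHa|/IHb]; [left|right|left|right].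
- by split=> -[x xP]; exists x; move: xP; rewrite IHa subtuple_up.
- by split=> xP x; move: (xP x); rewrite IHa subtuple_up.
Qed.

(** The syntax has no constant for truth; [exists x, x = x] is positive existential and holds
    because structures are nonempty. *)
Definition fTrue (S : signature) n : formula S n := fEx (fEq S ord0 ord0).

Lemma sat_fTrue (S : signature) (M : structure S) n (e : n.-tuple M) :
  sat (fTrue S n) e.
Proof. by have [x] := dom_inhabited M; exists x. Qed.

Definition bigand (S : signature) n (s : seq (formula S n)) : formula S n :=
  foldr (@fAnd S n) (fTrue S n) s.

Lemma sat_bigand (S : signature) (M : structure S) n m (phi : 'I_m -> formula S n)
    (e : n.-tuple M) :
  sat (bigand [seq phi i | i <- enum 'I_m]) e <-> forall i, sat (phi i) e.
Proof.
have -> : (forall i, sat (phi i) e) <-> forall i, i \in enum 'I_m -> sat (phi i) e.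
  by split=> h i => [_|]; apply: h => //; rewrite mem_enum.
elim: (enum _) => [|j s IHs] /=; first by split=> // _; apply: sat_fTrue.
split=> [[h /IHs hs] i|h].
  by rewrite inE => /predU1P[-> //|]; apply: hs.
by split; [|apply/IHs => i si]; apply: h; rewrite inE ?eqxx ?si ?orbT.
Qed.

Fixpoint exs (S : signature) k m : formula S (k + m) -> formula S m :=
  if k is k'.+1 then fun phi => exs (fEx phi) else id.

Lemma sat_exs (S : signature) (M : structure S) k m (phi : formula S (k + m))
    (d : m.-tuple M) :
  sat (exs phi) d <-> exists e : k.-tuple M, sat phi [tuple of e ++ d].
Proof.
elim: k phi => [|k IHk] phi /=.
  have dE (e : 0.-tuple M) : [tuple of e ++ d] = d by rewrite tuple0; apply: val_inj.
  split=> [h|[e]]; last by rewrite dE.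
  by exists [tuple of [::]]; rewrite dE.
have catE x (e : k.-tuple M) :
  [tuple of [tuple of x :: e] ++ d] = [tuple of x :: [tuple of e ++ d]].
  exact: val_inj.
rewrite IHk; split=> [[e [x]]|[e]] /=; first by rewrite -catE; exists [tuple of x :: e].
by case/tupleP: e => x e; rewrite catE; exists e, x.
Qed.

(* Universal closure; the type [formula S (m + 0)] avoids a cast in [exs].         *)
Definition alls (S : signature) m (phi : formula S (m + 0)) : sentence S :=
  fNot (exs (fNot phi)).

Lemma holds_alls (S : signature) (M : structure S) m (phi : formula S m) :
  holds M (alls (rename phi (@lshift m 0))) <-> forall e : m.-tuple M, sat phi e.
Proof.
rewrite /holds /alls /= sat_exs.
have catE (e : m.-tuple M) : subtuple (@lshift m 0) [tuple of e ++ [tuple of [::]]] = e.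
  by apply: eq_from_tnth => i; rewrite tnth_mktuple tnth_lshift.
split=> [h e|h [e]] /=.
  by apply: contrapT => ne; apply: h; exists e => /=; rewrite sat_rename catE.
by rewrite sat_rename catE; apply.
Qed.

(* The two instances are the positive existential formulas and all formulas.       *)
Record fragment (S : signature) (Q : forall n, formula S n -> Prop) : Prop := Fragment {
  fragment_eq n (i j : 'I_n) : Q n (fEq S i j);
  fragment_rel n (R : S) (v : (arity R).-tuple 'I_n) : Q n (fRel v);
  fragment_not n (a : formula S n) : Q n (fNot a) -> Q n a;
  fragment_and n (a b : formula S n) : Q n (fAnd a b) <-> Q n a /\ Q n b;
  fragment_or n (a b : formula S n) : Q n (fOr a b) -> Q n a /\ Q n b;
  fragment_ex n (a : formula S n.+1) : Q n (fEx a) <-> Q n.+1 a;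
  fragment_all n (a : formula S n.+1) : Q n (fAll a) -> Q n.+1 (fNot a);
  fragment_rename n (a : formula S n) m (f : 'I_n -> 'I_m) : Q n a -> Q m (rename a f) }.

Definition pe (S : signature) n (phi : formula S n) : Prop := positive_existential phi.
Definition fo (S : signature) n (phi : formula S n) : Prop := True.

Lemma fragment_fo (S : signature) : fragment (@fo S).
Proof. by []. Qed.

Lemma fragment_pe (S : signature) : fragment (@pe S).
Proof.
split=> //= [n a b|n a b|n a m f].
- by split=> [/andP|[? ?]] //; apply/andP.
- by move/andP.
- rewrite /pe; elim: a m f => //= {n} [n a IHa b IHb|n a IHa b IHb|n a IHa] m f.
  + by case/andP=> ? ?; rewrite IHa ?IHb.
  + by case/andP=> ? ?; rewrite IHa ?IHb.
  + exact: IHa.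
Qed.

(** * Types and isolated tuples relative to a fragment *)

Definition same_type (S : signature) (Q : forall n, formula S n -> Prop)
    (M N : structure S) n (e : n.-tuple M) (e' : n.-tuple N) : Prop :=
  forall phi, Q n phi -> (sat phi e <-> sat phi e').

(** The tuple lives in [M] but isolation is tested in [N], which is what back-and-forth between two
    structures consumes. *)
Definition isolates (S : signature) (Q : forall n, formula S n -> Prop)
    (M N : structure S) n (phi : formula S n) (e : n.-tuple M) : Prop :=
  [/\ Q n phi, sat phi e & forall e' : n.-tuple N, sat phi e' -> same_type Q e e'].

Definition isolated (S : signature) (Q : forall n, formula S n -> Prop)
    (M N : structure S) n (e : n.-tuple M) : Prop :=
  exists phi, isolates Q N phi e.

Section Fragment.
Variables (S : signature) (Q : forall n, formula S n -> Prop).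
Hypothesis Qfrag : fragment Q.

Lemma fragment_true n : Q (fTrue S n).
Proof. by apply/(fragment_ex Qfrag)/(fragment_eq Qfrag). Qed.

Lemma fragment_bigand n (s : seq (formula S n)) :
  (forall phi, List.In phi s -> Q phi) -> Q (bigand s).
Proof.
elim: s => [|a s IHs] h /=; first exact: fragment_true.
apply/(fragment_and Qfrag); split; first by apply: h; left.
by apply: IHs => phi ?; apply: h; right.
Qed.

Lemma fragment_bigand_map n m (phi : 'I_m -> formula S n) :
  (forall i, Q (phi i)) -> Q (bigand [seq phi i | i <- enum 'I_m]).
Proof.
move=> h; apply: fragment_bigand => a; elim: (enum _) => //= j s IHs [<-|]; [exact: h|exact: IHs].
Qed.

Lemma fragment_exs k m (phi : formula S (k + m)) : Q phi -> Q (exs phi).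
Proof. by elim: k phi => //= k IHk phi h; apply/IHk/(fragment_ex Qfrag). Qed.

Lemma same_type_subtuple (M N : structure S) m n (f : 'I_m -> 'I_n)
    (e : n.-tuple M) (e' : n.-tuple N) :
  same_type Q e e' -> same_type Q (subtuple f e) (subtuple f e').
Proof.
by move=> ee' phi /(fragment_rename Qfrag f) /ee'; rewrite !sat_rename.
Qed.

Lemma same_type_sym (M N : structure S) n (e : n.-tuple M) (e' : n.-tuple N) :
  same_type Q e e' -> same_type Q e' e.
Proof. by move=> ee' phi /ee' h; split=> /h. Qed.

Lemma same_type_trans (M N K : structure S) n (e : n.-tuple M) (e' : n.-tuple N)
    (e'' : n.-tuple K) :
  same_type Q e e' -> same_type Q e' e'' -> same_type Q e e''.
Proof. by move=> h h' phi Qphi; rewrite (h _ Qphi); exact: h'. Qed.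

(* A subtuple [d = e o f] is isolated by [exists e, phi e /\ d = e o f].           *)
Lemma isolated_subtuple (M N : structure S) m n (f : 'I_m -> 'I_n) (e : n.-tuple M) :
  isolated Q N e -> isolated Q N (subtuple f e).
Proof.
case=> phi [Qphi phie iso].
pose eqs i := fEq S (lshift m (f i)) (rshift n i).
pose psi := fAnd (rename phi (@lshift n m)) (bigand [seq eqs i | i <- enum 'I_m]).
have psiE (K : structure S) (d : m.-tuple K) :
    sat (exs psi) d <-> exists2 d' : n.-tuple K, sat phi d' & d = subtuple f d'.
  have lE (d' : n.-tuple K) : subtuple (@lshift n m) [tuple of d' ++ d] = d'.
    by apply: eq_from_tnth => i; rewrite tnth_mktuple tnth_lshift.
  rewrite sat_exs; split=> [[d']|[d' phid' dE]].
    rewrite /psi /= sat_rename lE sat_bigand => -[phid' eqsP]; exists d' => //.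
    apply: eq_from_tnth => i; rewrite tnth_mktuple.
    by have := eqsP i; rewrite /= tnth_lshift tnth_rshift.
  exists d'; rewrite /psi /= sat_rename lE sat_bigand; split=> // i.
  by rewrite /= tnth_lshift tnth_rshift dE tnth_mktuple.
exists (exs psi); split.
- apply/fragment_exs/(fragment_and Qfrag); split.
    exact: (fragment_rename Qfrag).
  by apply: fragment_bigand_map => i; exact: (fragment_eq Qfrag).
- by apply/psiE; exists e.
- by move=> d /psiE[d' phid' ->]; refine (same_type_subtuple _ (iso _ phid')).
Qed.

Lemma isolated_same_type (M N K : structure S) n (e : n.-tuple M) (e' : n.-tuple K) :
  same_type Q e e' -> isolated Q N e -> isolated Q N e'.
Proof.
move=> ee' [phi [Qphi phie iso]]; exists phi; split=> //.
  exact/(ee' _ Qphi).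
by move=> e'' phie''; apply: (same_type_trans (same_type_sym ee') (iso _ phie'')).
Qed.

(** The formula [fEx phi] belongs to the type of [e], so [e'] has a witness for it; isolation then
    upgrades [phi] to the whole type. *)
Lemma isolates_ext (M N : structure S) n (phi : formula S n.+1)
    (a : M) (e : n.-tuple M) (e' : n.-tuple N) :
  isolates Q N phi [tuple of a :: e] -> same_type Q e e' ->
  exists2 b : N, sat phi [tuple of b :: e'] &
    same_type Q [tuple of a :: e] [tuple of b :: e'].
Proof.
move=> [Qphi phiae iso] ee'.
have [|b phib] := (ee' (fEx phi) ((fragment_ex Qfrag phi).2 Qphi)).1.
  by exists a.
by exists b => //; exact: iso.
Qed.

End Fragment.

(** * Back and forth, atomic substructures *)

Lemma in_zip (T U : Type) n (e : n.-tuple T) (e' : n.-tuple U) x :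
  List.In x (zip e e') <-> exists i, tnth e i = x.1 /\ tnth e' i = x.2.
Proof.
have tE i : tnth [tuple of zip e e'] i = (tnth e i, tnth e' i).
  case: x => a b.
  by rewrite (tnth_nth (a, b)) nth_zip ?size_tuple // -!tnth_nth.
rewrite (in_tnth x [tuple of zip e e']); case: x tE => a b tE; split=> -[i].
  by rewrite tE => -[<- <-]; exists i.
by case=> /= <- <-; exists i; rewrite tE.
Qed.

(** A generic chain of finite matchings in [E], with one requirement for each element of [A] and of
    [B], has as union the graph of an isomorphism. *)
Lemma back_and_forth (S : signature) (A B : structure S)
    (E : forall n, n.-tuple A -> n.-tuple B -> Prop) :
  countable [set: A] -> countable [set: B] ->
  (forall n e e', E n e e' ->
     (forall i j, tnth e i = tnth e j <-> tnth e' i = tnth e' j) /\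
     (forall (R : S) (f : 'I_(arity R) -> 'I_n),
        interp (subtuple f e) <-> interp (subtuple f e'))) ->
  (forall n e e', E n e e' -> forall a, exists b,
     E n.+1 [tuple of a :: e] [tuple of b :: e']) ->
  (forall n e e', E n e e' -> forall b, exists a,
     E n.+1 [tuple of a :: e] [tuple of b :: e']) ->
  forall n e e', E n e e' ->
  exists2 f : A -> B, isomorphism f & e' = [tuple of map f e].
Proof.
move=> /countable_injection[fA fA_inj] /countable_injection[fB fB_inj] atoms forth back n e e' Eee'.
pose K := (A + B)%type.
have K_count : countable [set: K].
  apply/countable_injection.
  exists (fun k : K => choice.pickle
    (match k with inl a => inl (fA a) | inr b => inr (fB b) end : nat + nat)).
  move=> k k' /(pcan_inj choice.pickleK).
  by case: k k' => [a|b] [a'|b'] // [] => [/fA_inj|/fB_inj] ->.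
pose P (s : seq (A * B)) := exists m (d : m.-tuple A) (d' : m.-tuple B), E m d d' /\ s = zip d d'.
pose D (k : K) (s : seq (A * B)) (x : A * B) :=
  match k with inl a => x.1 = a | inr b => x.2 = b end.
have [a0] := dom_inhabited A.
have P0 : P (zip e e') by exists n, e, e'.
have [] := generic_chain (D := D) (inl a0 : K) K_count P0.
  move=> [a|b] _ [m [d [d' [Edd' ->]]]].
    have [b Eab] := forth _ _ _ Edd' a; exists (a, b) => //.
    by exists m.+1, [tuple of a :: d], [tuple of b :: d'].
  have [a Eab] := back _ _ _ Edd' b; exists (a, b) => //.
  by exists m.+1, [tuple of a :: d], [tuple of b :: d'].
move=> c [c0 Pc c_mono c_gen].
(* Finitely many pairs of the union already occur together in one stage, where the hypothesis on
   atoms applies. *)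
have stage m (h : 'I_m -> A * B) : (forall i, exists j, List.In (h i) (c j)) ->
    exists k (d : k.-tuple A) (d' : k.-tuple B) (v : 'I_m -> 'I_k),
      E k d d' /\ forall i, h i = (tnth d (v i), tnth d' (v i)).
  move=> /choice[J JP]; have [k [d [d' [Edd' cE]]]] := Pc (\max_i J i).
  have /choice[v vP] i : exists l, h i = (tnth d l, tnth d' l).
    have : List.In (h i) (c (\max_i J i)).
      by apply: (c_mono (J i)) => //; apply: leq_bigmax.
    by rewrite cE => /in_zip[l [hl hl']]; exists l; rewrite hl hl' -surjective_pairing.
  by exists k, d, d', v.
have total a : exists b, exists j, List.In (a, b) (c j).
  have [j [[a' b] [_ cj /= aE]]] := c_gen (inl a : K) 0.
  by exists b, j.+1; rewrite cj aE; left.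
have onto b : exists a, exists j, List.In (a, b) (c j).
  have [j [[a b'] [_ cj /= bE]]] := c_gen (inr b : K) 0.
  by exists a, j.+1; rewrite cj bE; left.
(* Two pairs in a common stage: the union is single-valued and injective at once. *)
have bij a b a' b' : (exists j, List.In (a, b) (c j)) ->
    (exists j, List.In (a', b') (c j)) -> (a = a' <-> b = b').
  move=> ab ab'.
  have [] := stage 2 (tnth [tuple (a, b); (a', b')]).
    by move=> i; case: (unliftP ord0 i) => [j|] ->; rewrite ?tnth0 // tnthS (ord1 j) tnth0.
  move=> k [d [d' [v [Edd' dP]]]].
  have := dP ord0; have := dP (lift ord0 ord0).
  rewrite tnthS !tnth0 => -[-> ->] [-> ->].
  exact: (atoms _ _ _ Edd').1.
have [f fP] := choice total; have [g gP] := choice onto.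
exists f; [split|].
- by exists g => x; [apply/(bij _ (f x) _ (f x))|apply/(bij (g x) _ (g x) _)].
- move=> R t; have [|k [d [d' [v [Edd' dP]]]]] := stage _ (fun i => (tnth t i, f (tnth t i))).
    by move=> i; exact: fP.
  have -> : t = subtuple v d.
    by apply: eq_from_tnth => i; rewrite tnth_mktuple; case: (dP i).
  have -> : [tuple of map f (subtuple v d)] = subtuple v d'.
    apply: eq_from_tnth => i; rewrite tnth_map !tnth_mktuple.
    by case: (dP i) => <- <-.
  exact: (atoms _ _ _ Edd').2.
- apply: eq_from_tnth => i; rewrite tnth_map.
  apply/(bij (tnth e i) _ (tnth e i)) => //.
  by exists 0; rewrite c0; apply/in_zip; exists i.
Qed.

(** * Isomorphisms, orbits, homomorphisms *)

Lemma isomorphism_sat (S : signature) (M N : structure S) (f : M -> N) :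
  isomorphism f -> forall n (phi : formula S n) (e : n.-tuple M),
  sat phi e <-> sat phi [tuple of map f e].
Proof.
move=> [[g fK gK] fR] n phi.
elim: phi => {n} /= [n i j|n R v|n a IHa|n a IHa b IHb|n a IHa b IHb|n a IHa|n a IHa] e.
- by rewrite !tnth_map; split=> [->//|/(can_inj fK)].
- by rewrite !map_tnth fR map_subtuple.
- by rewrite IHa.
- by rewrite IHa IHb.
- by rewrite IHa IHb.
- split=> -[x xP].
    by exists (f x); rewrite -map_tuple_cons -IHa.
  by exists (g x); rewrite IHa map_tuple_cons gK.
- split=> xP x; last by rewrite IHa map_tuple_cons.
  by rewrite -[x]gK -map_tuple_cons -IHa.
Qed.

Lemma isomorphism_id (S : signature) (M : structure S) : isomorphism (@id M).
Proof.
split=> [|R t]; first by exists id.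
by rewrite (_ : [tuple of map id t] = t) //; apply: eq_from_tnth => i; rewrite tnth_map.
Qed.

Lemma isomorphism_comp (S : signature) (M N K : structure S) (f : M -> N) (g : N -> K) :
  isomorphism f -> isomorphism g -> isomorphism (g \o f).
Proof.
move=> [f_bij fR] [g_bij gR]; split=> [|R t]; first exact: bij_comp.
rewrite fR gR (_ : [tuple of map g _] = [tuple of map (g \o f) t]) //.
by apply: eq_from_tnth => i; rewrite !tnth_map.
Qed.

Lemma isomorphism_inv (S : signature) (M N : structure S) (f : M -> N) :
  isomorphism f -> exists2 g : N -> M, isomorphism g & cancel f g /\ cancel g f.
Proof.
move=> [[g fK gK] fR]; exists g => //; split=> [|R t]; first by exists f.
rewrite fR (_ : [tuple of map f _] = t) //.
by apply: eq_from_tnth => i; rewrite !tnth_map gK.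
Qed.

Lemma aut_orbit_refl (S : signature) (M : structure S) n (e : n.-tuple M) : aut_orbit e e.
Proof.
exists id; first exact: isomorphism_id.
by apply: eq_from_tnth => i; rewrite tnth_map.
Qed.

Lemma aut_orbit_sym (S : signature) (M : structure S) n (e e' : n.-tuple M) :
  aut_orbit e e' -> aut_orbit e' e.
Proof.
move=> [f /isomorphism_inv[g g_iso [fK _]] ->]; exists g => //.
by apply: eq_from_tnth => i; rewrite !tnth_map fK.
Qed.

Lemma aut_orbit_trans (S : signature) (M : structure S) n (e e' e'' : n.-tuple M) :
  aut_orbit e e' -> aut_orbit e' e'' -> aut_orbit e e''.
Proof.
move=> [f f_iso ->] [g g_iso ->]; exists (g \o f); first exact: isomorphism_comp.
by apply: eq_from_tnth => i; rewrite !tnth_map.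
Qed.

Lemma aut_orbit_eq (S : signature) (M : structure S) n (e e' : n.-tuple M) :
  aut_orbit e e' -> aut_orbit e = aut_orbit e'.
Proof.
move=> ee'; apply/seteqP; split=> d; apply: aut_orbit_trans => //.
exact: aut_orbit_sym.
Qed.

Lemma aut_orbit_same_type (S : signature) (Q : forall n, formula S n -> Prop)
    (M : structure S) n (e e' : n.-tuple M) :
  aut_orbit e e' -> same_type Q e e'.
Proof. by move=> [f f_iso ->] phi _; exact: isomorphism_sat. Qed.

Lemma homomorphism_sat_pe (S : signature) (M N : structure S) (f : M -> N) :
  (forall (R : S) (t : (arity R).-tuple M), interp t -> interp [tuple of map f t]) ->
  forall n (phi : formula S n) (e : n.-tuple M),
  pe phi -> sat phi e -> sat phi [tuple of map f e].
Proof.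
move=> fR n phi; rewrite /pe.
elim: phi => {n} //= [n i j|n R v|n a IHa b IHb|n a IHa b IHb|n a IHa] e.
- by rewrite !tnth_map => _ ->.
- by move=> _; rewrite !map_tnth => /fR; rewrite map_subtuple.
- by case/andP=> pa pb [/(IHa _ pa) ? /(IHb _ pb)].
- by case/andP=> pa pb [/(IHa _ pa)|/(IHb _ pb)]; [left|right].
- by move=> pa [x /(IHa _ pa)]; rewrite map_tuple_cons; exists (f x).
Qed.

(** [isolates_ext] makes equality of [Q]-types a back-and-forth relation. As it is an equivalence of
    truth values, it also preserves the negations of atoms, even for positive [Q]. *)
Lemma atomic_isomorphism (S : signature) (Q : forall n, formula S n -> Prop)
    (A B : structure S) :
  fragment Q -> countable [set: A] -> countable [set: B] ->
  (forall n (e : n.-tuple A), isolated Q B e) ->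
  (forall n (e : n.-tuple B), isolated Q A e) ->
  forall n (e : n.-tuple A) (e' : n.-tuple B), same_type Q e e' ->
  exists2 f : A -> B, isomorphism f & e' = [tuple of map f e].
Proof.
move=> Qfrag cA cB isoA isoB; apply: back_and_forth => // n e e' ee'.
- split=> [i j|R f]; first exact: (ee' (fEq S i j) (fragment_eq Qfrag i j)).
  have := ee' (fRel [tuple f i | i < arity R]) (fragment_rel Qfrag _).
  rewrite /= !map_tnth.
  have -> : tnth [tuple f i | i < arity R] = f by apply/funext => i; rewrite tnth_mktuple.
  by [].
- move=> a; have [phi phiP] := isoA _ [tuple of a :: e].
  by have [b _ abP] := isolates_ext Qfrag phiP ee'; exists b.
- move=> b; have [phi phiP] := isoB _ [tuple of b :: e'].
  have [a _ abP] := isolates_ext Qfrag phiP (same_type_sym ee').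
  by exists a; apply: same_type_sym.
Qed.

Lemma atomic_oligomorphic (S : signature) (Q : forall n, formula S n -> Prop)
    (A : structure S) :
  fragment Q -> countable [set: A] ->
  (forall n (e : n.-tuple A), isolated Q A e) ->
  (forall n, exists m (r : 'I_m -> n.-tuple A),
     forall e : n.-tuple A, exists j, same_type Q e (r j)) ->
  oligomorphic A.
Proof.
move=> Qfrag cA isoA reps n; have [m [r rP]] := reps n.
apply: (finite_range_of_representatives (r := r)) => e.
have [j ej] := rP e; exists j.
exact/aut_orbit_eq/(atomic_isomorphism Qfrag).
Qed.

(** * Substructures and the Tarski-Vaught test for a fragment *)

Definition substructure (S : signature) (M : structure S) (A : set M)
    (A_ne : A !=set0) : structure S :=
  @Structure S {x : M | A x} (fun R t => interp [tuple of map sval t])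
    (let: ex_intro x Ax := A_ne in inhabits (exist _ x Ax)).

Lemma substructure_countable (S : signature) (M : structure S) (A : set M)
    (A_ne : A !=set0) : countable A -> countable [set: substructure A_ne].
Proof.
move=> /countable_injP[f f_inj]; apply/countable_injection.
exists (f \o sval) => -[x Ax] [y Ay] /= fxy.
by apply: eq_exist; apply: f_inj; rewrite ?inE.
Qed.

Lemma substructure_lift (S : signature) (M : structure S) (A : set M)
    (A_ne : A !=set0) n (e : n.-tuple M) : (forall i, A (tnth e i)) ->
  exists d : n.-tuple (substructure A_ne), e = [tuple of map sval d].
Proof.
move=> Ae; exists [tuple (exist _ _ (Ae i) : substructure A_ne) | i < n].
by apply: eq_from_tnth => i; rewrite tnth_map tnth_mktuple.
Qed.

Definition tarski_vaught (S : signature) (Q : forall n, formula S n -> Prop)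
    (M : structure S) (A : set M) : Prop :=
  forall n (phi : formula S n.+1) (e : n.-tuple M) (x : M), Q n.+1 phi ->
    (forall i, A (tnth e i)) -> sat phi [tuple of x :: e] ->
    exists2 y, A y & sat phi [tuple of y :: e].

Lemma tarski_vaught_sat (S : signature) (Q : forall n, formula S n -> Prop)
    (M : structure S) (A : set M) (A_ne : A !=set0) :
  fragment Q -> tarski_vaught Q A ->
  forall n (phi : formula S n) (e : n.-tuple (substructure A_ne)), Q n phi ->
  sat phi e <-> sat phi [tuple of map sval e].
Proof.
move=> Qfrag TV n phi.
have Ae m (e : m.-tuple (substructure A_ne)) i : A (tnth [tuple of map sval e] i).
  by rewrite tnth_map; exact: svalP.
elim: phi => {n} [n i j|n R v|n a IHa|n a IHa b IHb|n a IHa b IHb|n a IHa|n a IHa] e Qphi /=.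
- rewrite !tnth_map; split=> [->//|].
  by case: (tnth e i) (tnth e j) => x Ax [y Ay] /= xy; apply: eq_exist.
- suff -> : [tuple of map (tnth [tuple of map sval e]) v] =
            [tuple of map sval [tuple of map (tnth e) v]] by [].
  by apply: eq_from_tnth => i; rewrite !tnth_map.
- by rewrite (IHa _ (fragment_not Qfrag Qphi)).
- by have [Qa Qb] := (fragment_and Qfrag a b).1 Qphi; rewrite (IHa _ Qa) (IHb _ Qb).
- by have [Qa Qb] := fragment_or Qfrag Qphi; rewrite (IHa _ Qa) (IHb _ Qb).
- have Qa := (fragment_ex Qfrag a).1 Qphi; split=> [[x]|[x xP]].
    by rewrite (IHa _ Qa) map_tuple_cons; exists (sval x).
  have [y Ay yP] := TV _ _ _ _ Qa (Ae _ e) xP.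
  by exists (exist _ y Ay); rewrite (IHa _ Qa) map_tuple_cons.
(* A counterexample in [M] must be moved into [A], so the test is applied to the negated body; hence
   the closure condition [fragment_all]. *)
- have Qna := fragment_all Qfrag Qphi; have Qa := fragment_not Qfrag Qna.
  split=> xP x; last by rewrite (IHa _ Qa) map_tuple_cons.
  apply: contrapT => nx; have [y Ay yP] := TV _ _ _ _ Qna (Ae _ e) nx.
  by apply: yP; move: (xP (exist _ y Ay)); rewrite (IHa _ Qa) map_tuple_cons.
Qed.

(* The elements of [A] are chosen one at a time so that the tuple of all elements  *)
(* chosen so far is isolated: if [e] is isolated and [sat phi (x, e)], then an     *)
(* isolated tuple satisfying [phi (x, e)] and the isolating formula of [e] can be  *)
(* moved over [e]. Subtuples of isolated tuples are isolated.                      *)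
Theorem atomic_submodel (S : signature) (Q : forall n, formula S n -> Prop)
    (M : structure S) :
  fragment Q -> countable [set: M] ->
  (forall n, countable [set X : set (n.-tuple M) |
     exists2 phi, Q n phi & X = [set e | sat phi e]]) ->
  (forall n (phi : formula S n) (e : n.-tuple M), Q n phi -> sat phi e ->
     exists2 e' : n.-tuple M, isolated Q M e' & sat phi e') ->
  exists A : set M, [/\ A !=set0,
    forall n (e : n.-tuple M), (forall i, A (tnth e i)) -> isolated Q M e &
    tarski_vaught Q A].
Proof.
move=> Qfrag cM cQ dense.
(* [psi n] lists the fragment up to equivalence in [M]: the hypothesis counts definable relations,
   not formulas. *)
have /all_sig[psi psiP] n : {psi : nat -> formula S n | (forall i, Q n (psi i)) /\
    forall phi, Q n phi -> exists i, forall e : n.-tuple M, sat (psi i) e <-> sat phi e}.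
  apply: cid; have [|u [u_def u_onto]] := countable_enumeration (x0 := [set: n.-tuple M]) (cQ n).
    exists (fTrue S n); first exact: fragment_true.
    by apply/seteqP; split=> // e _; exact: sat_fTrue.
  have [psi psiP] := choice (fun k => (exists2P _ _).1 (u_def k)).
  exists psi; split=> [i|phi Qphi]; first exact: (psiP i).1.
  have [i ui] := u_onto [set e | sat phi e] (ex_intro2 _ _ phi Qphi erefl).
  by exists i => e; move: (psiP i).2; rewrite ui => /seteqP[h h']; split; [apply: h'|apply: h].
pose K := {n : nat & (nat * n.-tuple M)%type}.
have K_count : countable [set: K].
  have /countable_injection[f f_inj] := cM; apply/countable_injection.
  exists (fun k : K => choice.pickle (tag k, (tagged k).1, map f (tagged k).2)).
  move=> [n [i t]] [n' [i' t']] /(pcan_inj choice.pickleK)/= [nn' -> /(inj_map f_inj)].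
  by move: t'; rewrite -nn' => t' /val_inj ->.
pose P (s : seq M) := exists n (e : n.-tuple M), isolated Q M e /\ s = e.
(* The new element must witness the formula with index [i] over [t], if [t] is already in the stage
   and a witness exists in [M]; otherwise the requirement is vacuous. *)
pose D (k : K) (s : seq M) (x : M) :=
  let: existT n (i, t) := k in
  forall y, (forall j, List.In (tnth t j) s) ->
  sat (psi n.+1 i) [tuple of y :: t] -> sat (psi n.+1 i) [tuple of x :: t].
have extend n (e : n.-tuple M) (phi : formula S n.+1) y :
    isolated Q M e -> Q _ phi -> sat phi [tuple of y :: e] ->
    exists2 x, isolated Q M [tuple of x :: e] & sat phi [tuple of x :: e].
  move=> [chi [Qchi chie iso]] Qphi phiy.
  have [||d d_iso] := dense _ (fAnd phi (rename chi (lift ord0))) [tuple of y :: e].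
  - by apply/(fragment_and Qfrag); split=> //; exact: (fragment_rename Qfrag).
  - by split=> //; rewrite sat_rename subtuple_lift0.
  case/tupleP: d d_iso => z d d_iso /= [phiz]; rewrite sat_rename subtuple_lift0 => chid.
  have [theta thetaP] := d_iso.
  have [x thetax zx] := isolates_ext Qfrag thetaP (same_type_sym (iso _ chid)).
  exists x; last exact/(zx _ Qphi).
  exact: (isolated_same_type zx).
have [x0] := dom_inhabited M.
have P0 : P [::].
  exists 0, [tuple of [::]]; split=> //; exists (fTrue S 0); split.
  - exact: fragment_true.
  - exact: sat_fTrue.
  - by move=> e _; rewrite (_ : e = [tuple of [::]]) //; apply: val_inj; rewrite tuple0.
have [] := generic_chain (D := D) (existT _ 0 (0, [tuple of [::]]) : K) K_count P0.
  move=> [m [i t]] s [n [e [e_iso ->]]].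
  have [x x_iso xD] : exists2 x, isolated Q M [tuple of x :: e] & D (existT _ m (i, t)) e x.
    case: (pselect (exists2 y, (forall j, List.In (tnth t j) e) &
              sat (psi _ i) [tuple of y :: t])) => [[y te yP]|no].
      have [f tE] := subset_subtuple te.
      have upE x : subtuple (up f) [tuple of x :: e] = [tuple of x :: t].
        by rewrite subtuple_up -tE.
      have [||x x_iso xP] := extend _ _ (rename (psi _ i) (up f)) y e_iso.
      - by apply: (fragment_rename Qfrag); exact: (psiP _).1.
      - by rewrite sat_rename upE.
      by exists x => // z _ _; move: xP; rewrite sat_rename upE.
    have [|x x_iso _] := extend _ _ _ x0 e_iso (fragment_true Qfrag _).
      exact: sat_fTrue.
    by exists x => // y te yP; case: no; exists y.
  by exists x => //; exists n.+1, [tuple of x :: e].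
move=> c [c0 Pc c_mono c_gen].
pose A := [set x : M | exists j, List.In x (c j)].
have stage n (e : n.-tuple M) : (forall i, A (tnth e i)) ->
    exists j, forall i, List.In (tnth e i) (c j).
  move=> /choice[J JP]; exists (\max_i J i) => i.
  by apply: (c_mono (J i)) => //; apply: leq_bigmax.
exists A; split.
- have [j [x [_ cj _]]] := c_gen (existT _ 0 (0, [tuple of [::]])) 0.
  by exists x, j.+1; rewrite cj; left.
- move=> n e /stage[j ej]; have [m [d [d_iso cE]]] := Pc j.
  rewrite cE in ej; have [f ->] := subset_subtuple ej.
  exact: isolated_subtuple.
- move=> n phi e x Qphi /stage[j0 ej0] phix.
  have [i iP] := (psiP _).2 _ Qphi.
  have [j [y [j0j cj yD]]] := c_gen (existT _ n (i, e)) j0.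
  exists y; first by exists j.+1; rewrite cj; left.
  apply/iP/(yD x); last exact/iP.
  by move=> l; apply: (c_mono j0).
Qed.

(** * Weakly oligomorphic structures *)

(** The least relation definable by a [Q]-type that contains [e]. *)
Definition upset (S : signature) (Q : forall n, formula S n -> Prop)
    (M : structure S) n (e : n.-tuple M) : set (n.-tuple M) :=
  [set e' | forall phi, Q n phi -> sat phi e -> sat phi e'].

Lemma upset_same_type (S : signature) (Q : forall n, formula S n -> Prop)
    (M : structure S) n (e e' : n.-tuple M) :
  upset Q e e' -> upset Q e' e -> same_type Q e e'.
Proof. by move=> h h' phi Qphi; split; [apply: h|apply: h']. Qed.

(** For each of the finitely many upsets whose representative is not above [e], one formula true of
    [e] fails at the representative; their conjunction defines the upset of [e]. *)
Lemma isolating_upset (S : signature) (Q : forall n, formula S n -> Prop)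
    (M : structure S) n :
  fragment Q -> finite_set (range (@upset S Q M n)) ->
  forall e : n.-tuple M, exists phi, [/\ Q n phi, sat phi e &
    forall e' : n.-tuple M, sat phi e' -> upset Q e e'].
Proof.
move=> Qfrag /finite_range_representatives[m [r rP]] e.
have /choice[psi psiP] j : exists psi, [/\ Q n psi, sat psi e &
    sat psi (r j) -> upset Q e (r j)].
  case: (pselect (upset Q e (r j))) => [ej|/existsNP[psi]].
    by exists (fTrue S n); split=> //; [exact: fragment_true|exact: sat_fTrue].
  by move=> /not_implyP[Qpsi /not_implyP[psie npsi]]; exists psi.
exists (bigand [seq psi j | j <- enum 'I_m]); split.
- by apply: (fragment_bigand_map Qfrag) => j; case: (psiP j).
- by apply/sat_bigand => j; case: (psiP j).
- move=> e' /sat_bigand psie' phi Qphi phie; have [j ej] := rP e'.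
  have e'j : upset Q e' (r j) by rewrite ej.
  have : upset Q (r j) e' by rewrite -ej.
  by have [Qpsi _ psij] := psiP j; apply=> //; apply: psij => //; apply: e'j.
Qed.

Lemma isolated_dense (S : signature) (Q : forall n, formula S n -> Prop)
    (M : structure S) n :
  fragment Q -> finite_set (range (@upset S Q M n)) ->
  forall (phi : formula S n) (e : n.-tuple M), Q n phi -> sat phi e ->
  exists2 e' : n.-tuple M, isolated Q M e' & sat phi e'.
Proof.
move=> Qfrag Qfin phi e Qphi phie.
have iso := isolating_upset Qfrag Qfin.
have [m [r rP]] := finite_range_representatives Qfin.
have le_refl (d : n.-tuple M) : upset Q d d by [].
have le_trans (d1 d2 d3 : n.-tuple M) : upset Q d1 d2 -> upset Q d2 d3 -> upset Q d1 d3.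
  by move=> h h' psi Qpsi /(h _ Qpsi)/(h' _ Qpsi).
have rep d : exists j, upset Q d (r j) /\ upset Q (r j) d.
  by have [j dj] := rP d; exists j; rewrite {1}dj -{2}dj.
have [j0 [ej0 _]] := rep e.
(* Among the representatives above [e], one with the fewest representatives above *)
(* it has a maximal [Q]-type, and the upset of a maximal type is its class.        *)
have [j /asboolP ej j_min] := @arg_minnP _ j0 (fun j => `[< upset Q e (r j) >])
  (fun j => #|finset.finset (fun i => `[< upset Q (r j) (r i) >])|) (introT (asboolP _) ej0).
exists (r j); last exact: ej.
have [psi [Qpsi psij jpsi]] := iso (r j); exists psi; split=> // d /jpsi jd.
apply: upset_same_type => //; have [i [di id]] := rep d.
have ji := le_trans _ _ _ jd di.
have /j_min : `[< upset Q e (r i) >] by apply/asboolP/le_trans/ji.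
move=> card_ij; apply: (le_trans _ _ _ di).
have : finset.finset (fun k => `[< upset Q (r i) (r k) >]) =
       finset.finset (fun k => `[< upset Q (r j) (r k) >]).
  apply/eqP; rewrite finset.eqEcard card_ij andbT.
  by apply/fintype.subsetP => k; rewrite !finset.inE => /asboolP ik; apply/asboolP/le_trans/ik.
by move=> /setP/(_ j); rewrite !finset.inE [in RHS]asboolT // => /asboolP.
Qed.

Lemma weakly_oligomorphic_finite_upsets (S : signature) (M : structure S) n :
  weakly_oligomorphic M -> finite_set (range (@upset S (@pe S) M n)).
Proof.
move=> /(_ n); apply: sub_finite_set => _ [e _ <-].
exists [set phi | pe phi /\ sat phi e]; first by move=> phi [].
apply/seteqP; split=> [e' h phi [pphi phie]|e' h phi pphi phie]; first exact: h.
by apply: h; split.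
Qed.

Lemma weakly_oligomorphic_finite_definable (S : signature) (M : structure S) n :
  weakly_oligomorphic M ->
  finite_set [set X : set (n.-tuple M) | exists2 phi, pe phi & X = [set e | sat phi e]].
Proof.
move=> /(_ n); apply: sub_finite_set => X [phi pphi ->].
exists [set phi]; first by move=> _ ->.
by apply/seteqP; split=> [e phie psi ->|e]; last exact.
Qed.

Theorem oligomorphic_of_weakly_oligomorphic (S : signature) (M : structure S) :
  countable [set: M] -> weakly_oligomorphic M ->
  exists N : structure S,
    [/\ countable [set: N], oligomorphic N & pe_theory N = pe_theory M].
Proof.
move=> cM wM; have pefrag := fragment_pe S.
have [||A [A_ne A_iso TV]] := atomic_submodel pefrag cM.
- by move=> n; apply/finite_set_countable/weakly_oligomorphic_finite_definable.
- by move=> n; apply: (isolated_dense pefrag); exact: weakly_oligomorphic_finite_upsets.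
have sat_sub := tarski_vaught_sat (A_ne := A_ne) pefrag TV.
have cN : countable [set: substructure A_ne].
  by apply/substructure_countable/(sub_countable _ cM)/subset_card_le.
have same_sub n (e e' : n.-tuple (substructure A_ne)) :
    same_type (@pe S) [tuple of map sval e] [tuple of map sval e'] ->
    same_type (@pe S) e e'.
  by move=> ee' phi pphi; rewrite !sat_sub //; exact: ee'.
exists (substructure A_ne); split=> //.
- apply: (atomic_oligomorphic pefrag) => // n.
    move=> e; have [|phi [pphi phie iso]] := A_iso n [tuple of map sval e].
      by move=> i; rewrite tnth_map; exact: svalP.
    exists phi; split=> //; first by rewrite sat_sub.
    by move=> e'; rewrite sat_sub // => phie'; apply/same_sub/iso.
  have : finite_set (range (fun e : n.-tuple (substructure A_ne) =>
      upset (@pe S) [tuple of map sval e])).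
    apply: sub_finite_set (weakly_oligomorphic_finite_upsets n wM).
    by move=> _ [e _ <-]; exists [tuple of map sval e].
  move=> /finite_range_representatives[m [r rP]]; exists m, r => e.
  have [j ej] := rP e; exists j; apply/same_sub/upset_same_type.
    by rewrite ej.
  by rewrite -ej.
- apply/seteqP; split=> phi [pphi]; rewrite /holds => phiP; split=> //.
    move: phiP; rewrite sat_sub // (_ : [tuple of map sval _] = [tuple of [::]]) //.
    exact: val_inj.
  rewrite /holds sat_sub // (_ : [tuple of map sval _] = [tuple of [::]]) //.
  exact: val_inj.
Qed.

(** Automorphisms preserve all formulas, so a type-definable relation is a union of orbits, and
    finitely many orbits have finitely many unions. *)
Theorem oligomorphic_weakly_oligomorphic (S : signature) (M : structure S) :
  oligomorphic M -> weakly_oligomorphic M.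
Proof.
move=> oM n; have [m [r rP]] := finite_range_representatives (oM n).
have orbit_sat (e e' : n.-tuple M) : aut_orbit e = aut_orbit e' ->
    forall phi : formula S n, sat phi e <-> sat phi e'.
  move=> ee' phi; apply: (@aut_orbit_same_type _ (@fo S)) => //.
  by rewrite ee'; exact: aut_orbit_refl.
pose union (J : {ffun 'I_m -> bool}) := [set e | exists2 j, J j & aut_orbit e = aut_orbit (r j)].
apply: (@sub_finite_set _ _ (union @` [set: {ffun 'I_m -> bool}])).
  move=> _ [p _ ->]; exists [ffun j => `[< type_relation M p (r j) >]] => //.
  apply/seteqP; split=> [e [j]|e pe].
    rewrite ffunE => /asboolP pj ej phi pphi.
    by rewrite (orbit_sat _ _ ej); exact: pj.
  have [j ej] := rP e; exists j => //; rewrite ffunE; apply/asboolP => phi pphi.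
  by rewrite -(orbit_sat _ _ ej); exact: pe.
exact/finite_image/finite_finset.
Qed.

(** * Oligomorphic structures and categoricity *)

Lemma countably_infiniteP (T : Type) :
  countably_infinite T <-> countable [set: T] /\ exists f : nat -> T, injective f.
Proof.
rewrite /countably_infinite card_eq_le; split=> [/andP[cT /pcard_surjP[g g_onto]]|[cT [f f_inj]]].
  split=> //; have /choice[f fP] k : exists x, g x = k by have [x _ <-] := g_onto k I; exists x.
  by exists f; exact: can_inj fP.
apply/andP; split=> //; apply/pcard_surjP.
pose g x := if pselect (exists k, f k = x) is left h then projT1 (cid h) else 0.
exists g => k _; exists (f k) => //; rewrite /g; case: pselect => [h|[]]; last by exists k.
by case: (cid h) => k' /= /f_inj.
Qed.

(* An infinite substitute for [M], needed because [M] may be finite.               *)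
Definition blowup (S : signature) (M : structure S) : structure S :=
  @Structure S (M * nat)%type (fun R t => interp [tuple of map fst t])
    (let: inhabits x := dom_inhabited M in inhabits (x, 0)).

Lemma blowup_countably_infinite (S : signature) (M : structure S) :
  countable [set: M] -> countably_infinite (blowup M).
Proof.
move=> /countable_injection[f f_inj]; apply/countably_infiniteP; split.
  apply/countable_injection; exists (fun x => choice.pickle (f x.1, x.2)).
  by move=> [x k] [y l] /(pcan_inj choice.pickleK)[/f_inj -> ->].
have [x] := dom_inhabited M.
by exists (fun k => (x, k)) => k l [].
Qed.

Lemma pe_theory_blowup (S : signature) (M : structure S) :
  pe_theory (blowup M) = pe_theory M.
Proof.
have nilE (N N' : structure S) (f : N -> N') :
  [tuple of map f [tuple of [::]]] = [tuple of [::]] by exact: val_inj.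
apply/seteqP; split=> phi [pphi phiP]; split=> //; rewrite /holds.
  rewrite -(nilE (blowup M) M fst).
  by apply: homomorphism_sat_pe => // R t; rewrite /=.
rewrite -(nilE M (blowup M) (fun x => (x, 0))).
apply: homomorphism_sat_pe => // R t /=.
suff -> : [tuple of map fst [tuple of map (fun x : M => (x, 0)) t]] = t by [].
by apply: eq_from_tnth => i; rewrite !tnth_map.
Qed.

(** Relations of the blowup ignore the second coordinate, which therefore matters only through the
    equality pattern. *)
Definition similar (S : signature) (M : structure S) n (e e' : n.-tuple (blowup M)) : Prop :=
  aut_orbit [tuple of map fst e] [tuple of map fst e'] /\
  forall i j, tnth e i = tnth e j <-> tnth e' i = tnth e' j.

Lemma similar_sym (S : signature) (M : structure S) n (e e' : n.-tuple (blowup M)) :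
  similar e e' -> similar e' e.
Proof.
by move=> [/aut_orbit_sym ? eqP]; split=> // i j; rewrite eqP.
Qed.

Lemma similar_forth (S : signature) (M : structure S) n (e e' : n.-tuple (blowup M)) a :
  similar e e' -> exists b, similar [tuple of a :: e] [tuple of b :: e'].
Proof.
move=> [[g g_iso ge] eqP].
have [b [b1 bP]] : exists b : blowup M, b.1 = g a.1 /\
    forall i, a = tnth e i <-> b = tnth e' i.
  have geE i : (tnth e' i).1 = g (tnth e i).1.
    by have := congr1 (fun t => tnth t i) ge; rewrite !tnth_map.
  case: (pselect (exists i, a = tnth e i)) => [[i ->]|ae].
    by exists (tnth e' i); split=> // j; exact: eqP.
  (* A copy of [g a.1] outside [e']: its second coordinate exceeds all those occurring there. *)
  exists (g a.1, (\max_i (tnth e' i).2).+1); split=> // i; split=> [ai|bi].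
    by case: ae; exists i.
  have : (tnth e' i).2 <= \max_i (tnth e' i).2 by exact: (leq_bigmax i).
  by rewrite -bi ltnn.
exists b; split=> [|i j].
  exists g => //; rewrite map_tuple_cons ge; apply: val_inj => /=.
  by rewrite b1.
case: (unliftP ord0 i) (unliftP ord0 j) => [i'|] -> [j'|] ->; rewrite ?tnthS ?tnth0 //.
by split=> /esym/bP/esym.
Qed.

Lemma blowup_oligomorphic (S : signature) (M : structure S) :
  countable [set: M] -> oligomorphic M -> oligomorphic (blowup M).
Proof.
move=> cM oM n.
have [cB _] := (countably_infiniteP _).1 (blowup_countably_infinite cM).
have similar_orbit m (e e' : m.-tuple (blowup M)) : similar e e' -> aut_orbit e e'.
  move=> ee'; apply: (back_and_forth (E := @similar S M)) => // {m e e' ee'}.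
  - move=> m e e' [[g [_ gR] ge] eqP]; split=> // R f.
    by rewrite /= !map_subtuple ge -(map_subtuple g); exact: gR.
  - by move=> m e e' ee' a; exact: similar_forth.
  - move=> m e e' /similar_sym ee' b; have [a ab] := similar_forth b ee'.
    by exists a; exact: similar_sym.
pose F (e : n.-tuple (blowup M)) := (aut_orbit [tuple of map fst e],
  [ffun ij : 'I_n * 'I_n => `[< tnth e ij.1 = tnth e ij.2 >]]).
have : finite_set (range F).
  apply: sub_finite_set (finite_setX (oM n) (@finite_finset {ffun 'I_n * 'I_n -> bool} setT)).
  by move=> _ [e _ <-]; split=> //; exists [tuple of map fst e].
move=> /finite_range_representatives[m [r rP]].
apply: (finite_range_of_representatives (r := r)) => e; have [j [orb /ffunP eqs]] := rP e.
exists j; apply/aut_orbit_eq/similar_orbit; split.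
  by rewrite orb; exact: aut_orbit_refl.
move=> i k; have := eqs (i, k); rewrite !ffunE /= => ik.
by split=> /asboolP eik; apply/asboolP; [rewrite -ik|rewrite ik].
Qed.

(** * Elementary equivalence and uniqueness of the countable model *)

Definition elementarily_equivalent (S : signature) (M N : structure S) : Prop :=
  forall phi : sentence S, holds M phi <-> holds N phi.

Lemma elementarily_equivalent_valid (S : signature) (M N : structure S) n
    (phi : formula S n) :
  elementarily_equivalent M N ->
  (forall e : n.-tuple M, sat phi e) -> forall e : n.-tuple N, sat phi e.
Proof. by move=> MN; rewrite -!holds_alls MN. Qed.

(** Isolation says that [phi] implies [psi] or [fNot psi] throughout [M]; the universal closure of
    that implication passes to [N]. *)
Lemma elementarily_equivalent_isolates (S : signature) (M N : structure S) n
    (phi : formula S n) (e : n.-tuple M) :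
  elementarily_equivalent M N -> isolates (@fo S) M phi e -> isolates (@fo S) N phi e.
Proof.
move=> MN [_ phie iso]; split=> // e' phie' psi _; split=> [psie|psie'].
  have : sat (fOr (fNot phi) psi) e'; last by case.
  apply: (elementarily_equivalent_valid MN) => d /=.
  by case: (pselect (sat phi d)) => [phid|]; [right; apply/(iso _ phid psi I)|left].
apply: contrapT => npsi.
have : sat (fOr (fNot phi) (fNot psi)) e'; last by case.
apply: (elementarily_equivalent_valid MN) => d /=.
by case: (pselect (sat phi d)) => [phid|]; [right => /(iso _ phid psi I)|left].
Qed.

(** The disjunction of the formulas isolating the finitely many types is valid in [M], hence in [N];
    so [N] is atomic too and [atomic_isomorphism] applies to the empty tuples. *)
Lemma finitely_many_types_isomorphic (S : signature) (M N : structure S) :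
  countable [set: M] -> countable [set: N] ->
  (forall n (e : n.-tuple M), isolated (@fo S) M e) ->
  (forall n, exists m (r : 'I_m -> n.-tuple M),
     forall e : n.-tuple M, exists j, same_type (@fo S) e (r j)) ->
  elementarily_equivalent M N -> isomorphic M N.
Proof.
move=> cM cN isoM reps MN; have fofrag := fragment_fo S.
have [|n e'||f f_iso _] :=
  @atomic_isomorphism _ _ M N fofrag cM cN _ _ 0 [tuple of [::]] [tuple of [::]].
- move=> n e; have [phi phiP] := isoM n e; exists phi.
  exact: elementarily_equivalent_isolates.
- have [m [r rP]] := reps n.
  have [phi phiP] := choice (fun j => isoM n (r j)).
  have : sat (fNot (bigand [seq fNot (phi j) | j <- enum 'I_m])) e'.
    apply: (elementarily_equivalent_valid MN) => e /=; rewrite sat_bigand => /= none.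
    by have [j ej] := rP e; case: (none j); apply/(ej (phi j) I); case: (phiP j).
  rewrite /= sat_bigand => /existsNP[j /contrapT phije'].
  have [_ _ iso] := elementarily_equivalent_isolates MN (phiP j).
  exact: (isolated_same_type (iso _ phije')).
- by move=> phi _; exact: MN.
- by exists f.
Qed.

Lemma oligomorphic_finite_types (S : signature) (M : structure S) :
  oligomorphic M -> forall n,
  finite_set (range (@upset S (@fo S) M n)) /\
  exists m (r : 'I_m -> n.-tuple M), forall e : n.-tuple M, exists j, same_type (@fo S) e (r j).
Proof.
move=> oM n; have [m [r rP]] := finite_range_representatives (oM n).
have {}rP (e : n.-tuple M) : exists j, same_type (@fo S) e (r j).
  have [j ej] := rP e; exists j; apply: aut_orbit_same_type.
  by rewrite ej; exact: aut_orbit_refl.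
split; last by exists m, r.
apply: (finite_range_of_representatives (r := r)) => e; have [j ej] := rP e.
exists j; apply/seteqP; split=> d h phi Qphi.
  by move/(ej _ Qphi); exact: h.
by move/(ej _ Qphi); exact: h.
Qed.

Lemma finite_types_isolated (S : signature) (M : structure S) n :
  finite_set (range (@upset S (@fo S) M n)) -> forall e : n.-tuple M, isolated (@fo S) M e.
Proof.
move=> fin e; have [phi [Qphi phie iso]] := isolating_upset (fragment_fo S) fin e.
exists phi; split=> // e' /iso ee' psi _; split=> [|psie']; first exact: ee'.
by apply: contrapT => npsi; exact: (ee' (fNot psi) I npsi).
Qed.

Theorem omega_categorical_of_oligomorphic (S : signature) (M : structure S) :
  countable [set: M] -> oligomorphic M ->
  is_pe_part_of_omega_categorical (pe_theory M).
Proof.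
move=> cM oM; set B := blowup M.
have oB : oligomorphic B by exact: blowup_oligomorphic.
have iB := blowup_countably_infinite cM.
have [cB _] := (countably_infiniteP _).1 iB.
exists [set phi | holds B phi]; split.
- split=> phi; first by apply.
  by case: (pselect (holds B phi)) => ?; [left|right].
- exists B; split=> // N /countably_infiniteP[cN _] NB.
  apply: finitely_many_types_isomorphic => //.
  + by move=> n; apply: finite_types_isolated; case: (oligomorphic_finite_types oB n).
  + by move=> n; case: (oligomorphic_finite_types oB n).
  + move=> phi; split=> [|phiN]; first exact: NB.
    by apply: contrapT => nphi; exact: (NB (fNot phi) nphi).
- by rewrite -(pe_theory_blowup M).
Qed.

(** * Ultrapowers and elementary substructures *)

Fixpoint encode (S : signature) (c : S -> nat) n (phi : formula S n) :
    choice.GenTree.tree (seq nat) :=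
  match phi with
  | fEq _ i j => choice.GenTree.Leaf [:: 0; val i; val j]
  | fRel _ R v => choice.GenTree.Leaf (1 :: c R :: map val v)
  | fNot _ a => choice.GenTree.Node 0 [:: encode c a]
  | fAnd _ a b => choice.GenTree.Node 1 [:: encode c a; encode c b]
  | fOr _ a b => choice.GenTree.Node 2 [:: encode c a; encode c b]
  | fEx _ a => choice.GenTree.Node 3 [:: encode c a]
  | fAll _ a => choice.GenTree.Node 4 [:: encode c a]
  end.

(** The code does not record the number of free variables; carrying the equation [mn] leaves the
    index of [psi] free for case analysis. *)
Lemma encode_inj (S : signature) (c : S -> nat) : injective c ->
  forall n (phi : formula S n) m (psi : formula S m) (mn : m = n),
  encode c phi = encode c psi -> phi = eq_rect m (formula S) psi n mn.
Proof.
move=> c_inj n phi.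
elim: phi => {n} [n i j|n R v|n a IHa|n a IHa b IHb|n a IHa b IHb|n a IHa|n a IHa] m psi;
  case: psi => {m} [m i' j'|m R' v'|m a'|m a' b'|m a' b'|m a'|m a'] mn //; subst; move=> /= [].
- by move=> /val_inj -> /val_inj ->.
- move=> /c_inj RR'; subst R'.
  by move=> /(inj_map val_inj)/val_inj ->.
- by move=> /(IHa _ _ erefl) ->.
- by move=> /(IHa _ _ erefl) -> /(IHb _ _ erefl) ->.
- by move=> /(IHa _ _ erefl) -> /(IHb _ _ erefl) ->.
- by move=> /(IHa _ _ erefl) ->.
- by move=> /(IHa _ _ erefl) ->.
Qed.

Lemma countable_formula (S : signature) n :
  countable [set: S] -> countable [set: formula S n].
Proof.
move=> /countable_injection[c c_inj]; apply/countable_injection.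
exists (choice.pickle \o encode c (n := n)) => phi psi.
by move=> /(pcan_inj choice.pickleK)/(encode_inj c_inj erefl).
Qed.

Lemma countable_tuples (T : Type) (A : set T) n :
  countable A -> countable [set e : n.-tuple T | forall i, A (tnth e i)].
Proof.
move=> /countable_injP[f f_inj]; apply/countable_injP.
exists (fun e => choice.pickle (map f e)) => e e'; rewrite !inE => Ae Ae'.
move=> /(pcan_inj choice.pickleK) ee'; apply: eq_from_tnth => i.
apply: f_inj; rewrite ?inE //.
have : [tuple of map f e] = [tuple of map f e'] by apply: val_inj.
by move/(congr1 (fun t => tnth t i)); rewrite !tnth_map.
Qed.

Section Ultrapower.
Variables (S : signature) (M : structure S) (I : Type) (U : set_system I).
Hypothesis U_ultra : UltraFilter U.

(** Classes are sets of functions, so equality in the ultrapower is plain equality; relations are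
    read off chosen representatives. *)
Definition ultraclass (f : I -> M) : set (I -> M) := [set g | U [set k | f k = g k]].

Lemma ultraclass_eq (f g : I -> M) :
  ultraclass f = ultraclass g <-> U [set k | f k = g k].
Proof.
split=> [fg|fg].
  suff : ultraclass g g by rewrite -fg.
  by apply: filterS filterT.
by apply/seteqP; split=> h gh; apply: filterS (filterI fg gh) => k [] /= -> ->.
Qed.

Definition ultrapower_interp (rep : {X | exists f, X = ultraclass f} -> I -> M)
    (R : S) (t : (arity R).-tuple {X | exists f, X = ultraclass f}) : Prop :=
  U [set k | interp [tuple of map (rep^~ k) t]].

Definition representative (X : {X | exists f, X = ultraclass f}) : I -> M :=
  projT1 (cid (svalP X)).

Definition ultrapower : structure S :=
  @Structure S {X | exists f, X = ultraclass f} (ultrapower_interp representative)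
    (let: inhabits x := dom_inhabited M in
     inhabits (exist _ (ultraclass (fun=> x)) (ex_intro _ (fun=> x) erefl))).

Definition ultrapower_class (f : I -> M) : ultrapower :=
  exist _ (ultraclass f) (ex_intro _ f erefl).

Lemma representative_class (f : I -> M) :
  U [set k | f k = representative (ultrapower_class f) k].
Proof.
by rewrite -ultraclass_eq /representative; case: cid => g.
Qed.

Lemma representative_inj (X Y : ultrapower) :
  U [set k | representative X k = representative Y k] <-> X = Y.
Proof.
split=> [|->]; last exact: filterS filterT.
rewrite -ultraclass_eq /representative.
case: X Y => [X Xf] [Y Yf]; case: cid => f /= Ef; case: cid => g /= Eg fg.
by apply: eq_exist; rewrite Ef Eg.
Qed.

Definition ultrapower_eval n (e : n.-tuple ultrapower) (k : I) : n.-tuple M :=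
  [tuple of map (representative^~ k) e].

Lemma ultrapower_eval_cons n X (e : n.-tuple ultrapower) k :
  ultrapower_eval [tuple of X :: e] k =
  [tuple of representative X k :: ultrapower_eval e k].
Proof. exact: val_inj. Qed.

Lemma ultrafilter_not (A : set I) : U (~` A) <-> ~ U A.
Proof.
split=> [nA UA|]; last by case: (in_ultra_setVsetC A U_ultra).
have : U set0 by rewrite -(setICr A); exact: filterI.
exact: filter_not_empty.
Qed.

Theorem los n (phi : formula S n) (e : n.-tuple ultrapower) :
  sat phi e <-> U [set k | sat phi (ultrapower_eval e k)].
Proof.
elim: phi e => {n} /= [n i j|n R v|n a IHa|n a IHa b IHb|n a IHa b IHb|n a IHa|n a IHa] e.
- rewrite -representative_inj; apply: iff_sym.
  by under eq_set do rewrite !tnth_map.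
- rewrite /ultrapower_interp.
  suff h k : [tuple of map (representative^~ k) [tuple of map (tnth e) v]] =
           [tuple of map (tnth (ultrapower_eval e k)) v].
    by split; apply: filterS => k /=; rewrite h.
  by apply: eq_from_tnth => i; rewrite !tnth_map.
- by rewrite IHa -ultrafilter_not.
- rewrite IHa IHb; split=> [[? ?]|h]; first exact: filterI.
  by split; apply: filterS h => k [].
- rewrite IHa IHb; split=> [[]|]; [by apply: filterS; left|by apply: filterS; right|].
  move=> h.
  case: (in_ultra_setVsetC [set k | sat a (ultrapower_eval e k)] U_ultra) => [|na].
    by left.
  by right; apply: filterS (filterI h na) => k [] [].
- split=> [[X /IHa]|h].
    by apply: filterS => k; rewrite /= ultrapower_eval_cons; exists (representative X k).
  have /choice[f fP] k : exists x, (exists y, sat a [tuple of y :: ultrapower_eval e k]) ->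
      sat a [tuple of x :: ultrapower_eval e k].
    case: (pselect (exists y, sat a [tuple of y :: ultrapower_eval e k])) => [[y yP]|no].
      by exists y.
    by have [x] := dom_inhabited M; exists x.
  exists (ultrapower_class f); apply/IHa.
  apply: filterS (filterI h (representative_class f)) => k [/fP fk] /= Ek.
  by rewrite ultrapower_eval_cons -Ek.
- split=> [h|h X]; last first.
    by apply/IHa; apply: filterS h => k /= h; rewrite ultrapower_eval_cons; exact: h.
  apply: contrapT => /ultrafilter_not nh.
  (* [f k] is a counterexample at [k] whenever there is one. *)
  have /choice[f fP] k : exists x, sat a [tuple of x :: ultrapower_eval e k] ->
      forall x, sat a [tuple of x :: ultrapower_eval e k].
    case: (pselect (forall x, sat a [tuple of x :: ultrapower_eval e k])) => [all|/existsNP[x nx]].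
      by have [x] := dom_inhabited M; exists x.
    by exists x.
  have /IHa hf := h (ultrapower_class f).
  have [k [[nk]]] := filter_ex (filterI (filterI nh hf) (representative_class f)).
  rewrite /= ultrapower_eval_cons => hk Ek.
  by apply: nk; apply: fP; rewrite Ek.
Qed.

Lemma ultrapower_equivalent : elementarily_equivalent M ultrapower.
Proof.
move=> phi; rewrite /holds los.
have E k : ultrapower_eval [tuple of [::]] k = [tuple of [::]] by exact: val_inj.
split=> [h|/filter_ex[k]]; last by rewrite /= E.
by apply: filterS filterT => k _ /=; rewrite E.
Qed.

End Ultrapower.

(** [A0] is closed under Skolem functions in countably many rounds, each adding countably many
    values. *)
Theorem downward_loewenheim_skolem (S : signature) (M : structure S) (A0 : set M) :
  countable [set: S] -> countable A0 ->
  exists A : set M, [/\ A0 `<=` A, countable A & tarski_vaught (@fo S) A].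
Proof.
move=> cS cA0; have [x0] := dom_inhabited M.
have sk_ex n (phi : formula S n.+1) (e : n.-tuple M) : {x : M |
    (exists y, sat phi [tuple of y :: e]) -> sat phi [tuple of x :: e]}.
  apply: cid; case: (pselect (exists y, sat phi [tuple of y :: e])) => [[y yP]|no].
    by exists y.
  by exists x0.
pose sk n phi e := sval (@sk_ex n phi e).
pose closure A := A `|` \bigcup_(n in [set: nat]) \bigcup_(phi in [set: formula S n.+1])
  (sk n phi @` [set e : n.-tuple M | forall i, A (tnth e i)]).
pose A_ := fix A_ j := if j is i.+1 then closure (A_ i) else A0.
have A_mono i j : i <= j -> A_ i `<=` A_ j.
  elim: j => [|j IHj]; first by rewrite leqn0 => /eqP ->.
  by rewrite leq_eqVlt => /predU1P[-> //|]; rewrite ltnS => /IHj h x /h; left.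
exists (\bigcup_j A_ j); split.
- by move=> x A0x; exists 0.
- apply: bigcup_countable => // j _; elim: j => //= j IHj.
  rewrite /closure -bigcup2E; apply: bigcup_countable => // -[|[|k]] _ //=.
  apply: bigcup_countable => // n _; apply: bigcup_countable => [|phi _].
    exact: countable_formula.
  by apply: (sub_countable (card_image_le _ _)); exact: countable_tuples.
- move=> n phi e x _ eA phix.
  have [J JP] := choice (fun i => (exists2P _ _).1 (eA i)).
  exists (sk n phi e); last by apply: (svalP (sk_ex n phi e)); exists x.
  exists (\max_i J i).+1 => //; right; exists n => //; exists phi => //; exists e => //.
  by move=> i; apply: (A_mono (J i)); [exact: leq_bigmax|case: (JP i)].
Qed.

(** * The theorem of Ryll-Nardzewski *)

Lemma substructure_equivalent (S : signature) (M : structure S) (A : set M)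
    (A_ne : A !=set0) :
  tarski_vaught (@fo S) A -> elementarily_equivalent M (substructure A_ne).
Proof.
move=> TV phi; rewrite /holds (tarski_vaught_sat (fragment_fo S) TV) //.
by rewrite (_ : [tuple of map sval _] = [tuple of [::]]) //; exact: val_inj.
Qed.

(** In an ultrapower over a nonprincipal ultrafilter on [nat], the class of a sequence of solutions
    of the successive [phi k] satisfies every [phi k], since the formulas decrease. *)
Theorem realize_in_extension (S : signature) (M : structure S) n (phi : nat -> formula S n) :
  countable [set: S] -> countably_infinite M ->
  (forall k (e : n.-tuple M), sat (phi k.+1) e -> sat (phi k) e) ->
  (forall k, exists e : n.-tuple M, sat (phi k) e) ->
  exists N : structure S, [/\ countably_infinite N, elementarily_equivalent M N &
    exists e : n.-tuple N, forall k, sat (phi k) e].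
Proof.
move=> cS /countably_infiniteP[/countable_injection[c c_inj] [u u_inj]] decr /choice[a aP].
have {}decr k l (e : n.-tuple M) : k <= l -> sat (phi l) e -> sat (phi k) e.
  elim: l => [|l IHl]; first by rewrite leqn0 => /eqP ->.
  by rewrite leq_eqVlt => /predU1P[-> //|]; rewrite ltnS => /IHl h /decr.
have [U [U_ultra U_inf]] := ultraFilterLemma eventually_filter.
pose d : n.-tuple (ultrapower M U) := [tuple ultrapower_class U (fun k => tnth (a k) i) | i < n].
have dP k : sat (phi k) d.
  apply/(los U_ultra).
  have Uk : U [set l | k <= l] by apply: U_inf; exists k.
  have Ud : U [set l | forall i, tnth (a l) i = representative (tnth d i) l].
    apply: (@filter_forall _ _ (fun i l => tnth (a l) i = representative (tnth d i) l) U) => i.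
    by rewrite tnth_mktuple; exact: representative_class.
  apply: filterS (filterI Uk Ud) => l [kl dl] /=.
  rewrite (_ : ultrapower_eval d l = a l); first exact: decr kl (aP l).
  by apply: eq_from_tnth => i; rewrite tnth_map dl.
(* The entries of [d] keep the realization in the countable substructure; the diagonal copy of [M]
   keeps that substructure infinite. *)
pose g (x : M + 'I_n) : ultrapower M U :=
  match x with inl y => ultrapower_class U (fun=> y) | inr i => tnth d i end.
have [|A [A0A cA TV]] := @downward_loewenheim_skolem S (ultrapower M U) (range g) cS.
  apply: (sub_countable (card_image_le _ _)); apply/countable_injection.
  exists (fun x => choice.pickle
    (match x with inl y => inl (c y) | inr i => inr i end : nat + 'I_n)).
  move=> x y /(pcan_inj choice.pickleK).
  by case: x y => [x|i] [y|j] // [] => [/c_inj|] ->.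
have Ag x : A (g x) by apply: A0A; exists x.
have A_ne : A !=set0 by exists (g (inl (u 0))).
exists (substructure A_ne); split.
- apply/countably_infiniteP; split; first exact: substructure_countable.
  exists (fun k => exist _ _ (Ag (inl (u k)))) => k l.
  move=> /(congr1 (sval \o sval))/(ultraclass_eq U_ultra (fun=> u k)) kl.
  by have [_ /u_inj] := filter_ex kl.
- move=> psi; rewrite -substructure_equivalent //; exact: ultrapower_equivalent.
- have [|e dE] := @substructure_lift _ _ _ A_ne _ d; first by move=> i; exact: (Ag (inr i)).
  by exists e => k; rewrite (tarski_vaught_sat (fragment_fo S) TV) // -dE.
Qed.

Section RyllNardzewski.
Variables (S : signature) (M : structure S).
Hypothesis S_countable : countable [set: S].
Hypothesis M_infinite : countably_infinite M.
Hypothesis M_categorical : forall N : structure S,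
  countably_infinite N -> elementarily_equivalent M N -> isomorphic M N.

Let M_countable : countable [set: M].
Proof. by case/countably_infiniteP: M_infinite. Qed.

(* Otherwise a sequence of members of [C] excluding the tuples of [M] one by one  *)
(* would be realized in some countable model of the theory of [M], hence in [M].  *)
Lemma no_avoiding_family n (C : formula S n -> Prop) :
  (forall phi, C phi -> exists e : n.-tuple M, sat phi e) ->
  (forall phi (e : n.-tuple M), C phi -> exists psi,
     [/\ C psi, forall d : n.-tuple M, sat psi d -> sat phi d & ~ sat psi e]) ->
  forall phi, ~ C phi.
Proof.
move=> C_sat C_avoid phi0 Cphi0; have [e0 _] := C_sat _ Cphi0.
have tuples_countable : countable [set: n.-tuple M].
  apply: sub_countable (@countable_tuples _ _ n M_countable).
  by apply: subset_card_le => e _ i.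
have [u [_ u_onto]] := countable_enumeration (x0 := e0) tuples_countable I.
have /choice[next nextP] (pe : formula S n * n.-tuple M) : exists psi, C pe.1 ->
    [/\ C psi, forall d : n.-tuple M, sat psi d -> sat pe.1 d & ~ sat psi pe.2].
  case: (pselect (C pe.1)) => [/(C_avoid _ pe.2)[psi psiP]|nC]; first by exists psi.
  by exists phi0.
pose phi := fix phi k := if k is l.+1 then next (phi l, u l) else phi0.
have Cphi k : C (phi k) by elim: k => //= k IHk; case: (nextP (phi k, u k) IHk).
have [||N [N_inf MN [e eP]]] := realize_in_extension (phi := phi) S_countable M_infinite.
- by move=> k e; have [_ h _] := nextP (phi k, u k) (Cphi k); exact: h.
- by move=> k; exact: C_sat.
have [f /isomorphism_inv[g g_iso _]] := M_categorical N_inf MN.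
have [k ke] := u_onto [tuple of map g e] I.
have : sat (phi k.+1) [tuple of map g e] by apply/(isomorphism_sat g_iso)/eP.
by rewrite -ke; case: (nextP (phi k, u k) (Cphi k)).
Qed.

(** If no isolated tuple satisfies [phi], every satisfiable [psi] implying [phi] splits, and the
    half avoiding a given tuple is again satisfiable: an avoiding family. *)
Lemma isolated_tuples_dense n (phi : formula S n) (e : n.-tuple M) :
  sat phi e -> exists2 e' : n.-tuple M, isolated (@fo S) M e' & sat phi e'.
Proof.
move=> phie; apply: contrapT => none.
pose C psi := (exists d : n.-tuple M, sat psi d) /\
  forall d : n.-tuple M, sat psi d -> sat phi d.
apply: (@no_avoiding_family n C _ _ phi); last by split=> //; exists e.
  by move=> psi [].
move=> psi d [psi_sat psi_phi]; case: (pselect (sat psi d)) => [psid|npsid]; last by exists psi.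
have [chi [chid [d' psid' nchid']]] : exists chi, sat chi d /\
    exists2 d' : n.-tuple M, sat psi d' & ~ sat chi d'.
  apply: contrapT => all; apply: none; exists d; last exact: psi_phi.
  exists psi; split=> // d' psid' chi _; split=> [chid|chid'].
    by apply: contrapT => nchid'; apply: all; exists chi; split=> //; exists d'.
  by apply: contrapT => nchid; apply: all; exists (fNot chi); split=> //; exists d'.
exists (fAnd psi (fNot chi)); split=> /=.
- by split=> [|d2 [/psi_phi]//]; exists d'.
- by move=> d2 [].
- by case.
Qed.

(** If the substructure were enumerated by a finite tuple, the Tarski-Vaught test would put into it
    a further element distinct from all entries. *)
Lemma elementary_substructure_infinite (A : set M) (A_ne : A !=set0) :
  tarski_vaught (@fo S) A -> countably_infinite (substructure A_ne).
Proof.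
move=> TV; apply: eq_card_nat.
  by apply/substructure_countable/(sub_countable _ M_countable)/subset_card_le.
move=> fin; have [|m [r rP]] := @finite_range_representatives (substructure A_ne) _ id.
  by apply: sub_finite_set fin.
pose t := [tuple sval (r i) | i < m].
have [x xt] : exists x, forall i, x <> tnth t i.
  have [_ [u u_inj]] := (countably_infiniteP M).1 M_infinite.
  apply: contrapT => none.
  have /choice[h hP] (k : 'I_m.+1) : exists i, u k = tnth t i.
    by apply: contrapT => nk; apply: none; exists (u k) => i ki; apply: nk; exists i.
  have /leq_card : injective h by move=> k l kl; apply/val_inj/u_inj; rewrite !hP kl.
  by rewrite !card_ord ltnn.
pose phi := bigand [seq fNot (fEq S ord0 (lift ord0 i)) | i <- enum 'I_m].
have phiE y : sat phi [tuple of y :: t] <-> forall i, y <> tnth t i.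
  by rewrite sat_bigand; split=> h i; have := h i; rewrite /= tnth0 tnthS.
have [||y Ay /phiE yt] := TV _ phi t x I; last 1 first.
- by have [i yi] := rP (exist _ y Ay); apply: (yt i); rewrite tnth_mktuple -yi.
- by move=> i; rewrite tnth_mktuple; exact: svalP.
- exact/phiE.
Qed.

(** Categoricity makes [M] isomorphic to its atomic elementary substructure, and [satE] carries
    isolation back along this elementary self-embedding. *)
Lemma categorical_atomic n (e : n.-tuple M) : isolated (@fo S) M e.
Proof.
have fofrag := fragment_fo S.
have [||A [A_ne A_iso TV]] := atomic_submodel fofrag M_countable.
- move=> m; apply: sub_countable (countable_formula m S_countable).
  apply: card_le_trans (card_image_le (fun phi => [set e : m.-tuple M | sat phi e]) _).
  by apply: subset_card_le => X [phi _ ->]; exists phi.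
- by move=> m phi d _; exact: isolated_tuples_dense.
have [f f_iso] := M_categorical (elementary_substructure_infinite A_ne TV)
  (substructure_equivalent A_ne TV).
have satE m (d : m.-tuple M) (phi : formula S m) :
    sat phi d <-> sat phi [tuple of map sval [tuple of map f d]].
  by rewrite (isomorphism_sat f_iso) (tarski_vaught_sat fofrag TV).
have [|phi [_ phie iso]] := A_iso n [tuple of map sval [tuple of map f e]].
  by move=> i; rewrite tnth_map; exact: svalP.
exists phi; split=> //; first exact/satE.
move=> d /satE phid psi _; rewrite (satE _ e) (satE _ d).
exact: (iso _ phid psi I).
Qed.

(** The formulas whose solutions have infinitely many types would form an avoiding family:
    conjoining the negation of the formula isolating [e] excludes [e] and removes only one type. *)
Lemma categorical_finitely_many_types n :
  exists m (r : 'I_m -> n.-tuple M), forall e : n.-tuple M, exists j, same_type (@fo S) e (r j).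
Proof.
pose covered phi := exists m (r : 'I_m -> n.-tuple M), forall e : n.-tuple M,
  sat phi e -> exists j, same_type (@fo S) e (r j).
suff : ~ ~ covered (fTrue S n).
  move=> /contrapT[m [r rP]]; exists m, r => e.
  by apply: rP; exact: sat_fTrue.
apply: (@no_avoiding_family n (fun phi => ~ covered phi)) => [phi nphi|phi e nphi].
  apply: contrapT => none; apply: nphi; have r (i : 'I_0) : n.-tuple M by case: i.
  by exists 0, r => e phie; case: none; exists e.
have [chi [_ chie iso]] := categorical_atomic e.
exists (fAnd phi (fNot chi)); split=> [|d /= []|/= []] //.
move=> [m [r rP]]; apply: nphi.
exists m.+1, (fun i => if unlift ord0 i is Some j then r j else e) => d phid.
case: (pselect (sat chi d)) => [chid|nchid].
  by exists ord0; rewrite unlift_none; exact: (same_type_sym (iso _ chid)).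
by have [|j dj] := rP d; [split|exists (lift ord0 j); rewrite liftK].
Qed.

Theorem categorical_oligomorphic : oligomorphic M.
Proof.
apply: (atomic_oligomorphic (fragment_fo S)) => //.
  exact: categorical_atomic.
exact: categorical_finitely_many_types.
Qed.

End RyllNardzewski.

(** By completeness [Th] is exactly the set of sentences true in [M], so structures elementarily
    equivalent to [M] are models of [Th]. *)
Theorem oligomorphic_of_omega_categorical (S : signature) (T : set (sentence S)) :
  countable [set: S] ->
  is_pe_part_of_omega_categorical T -> is_pe_theory_of_oligomorphic T.
Proof.
move=> cS [Th [[_ Th_complete] [M [M_inf ThM M_cat]] ->]].
have ThE phi : Th phi <-> holds M phi.
  split=> [/ThM//|Mphi]; have [//|/ThM] := Th_complete phi.
  by rewrite /holds /=.
exists M; split.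
- by case/countably_infiniteP: M_inf.
- apply: categorical_oligomorphic => // N N_inf MN.
  by apply: M_cat => // phi /ThM; rewrite MN.
- by apply/seteqP; split=> phi [pphi /ThE].
Qed.

(* Over an uncountable signature, being the positive existential part of an     *)
(* omega-categorical theory implies neither of the other two conditions: the    *)
(* complete theory of nat with all finitary relations has no countable model    *)
(* but nat, and its positive existential part makes the singletons nonempty     *)
(* and pairwise disjoint. The other implications hold over every signature.     *)
Theorem mainTheorem16 (S : signature) (T : set (sentence S))
    (T_pe : forall phi : sentence S, T phi -> positive_existential phi) :
  (countable [set: S] ->
     (is_pe_theory_of_weakly_oligomorphic T <->
        is_pe_part_of_omega_categorical T) /\
     (is_pe_part_of_omega_categorical T <->
        is_pe_theory_of_oligomorphic T)) /\
  (is_pe_theory_of_weakly_oligomorphic T <-> is_pe_theory_of_oligomorphic T) /\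
  (is_pe_theory_of_oligomorphic T -> is_pe_part_of_omega_categorical T).
Proof.
have wo : is_pe_theory_of_weakly_oligomorphic T -> is_pe_theory_of_oligomorphic T.
  move=> [M [cM wM ->]].
  by have [N [cN oN <-]] := oligomorphic_of_weakly_oligomorphic cM wM; exists N.
have ow : is_pe_theory_of_oligomorphic T -> is_pe_theory_of_weakly_oligomorphic T.
  by move=> [M [cM /oligomorphic_weakly_oligomorphic wM ->]]; exists M.
have oc : is_pe_theory_of_oligomorphic T -> is_pe_part_of_omega_categorical T.
  by move=> [M [cM oM ->]]; exact: omega_categorical_of_oligomorphic.
split; last by do !split.
move=> cS; have co := @oligomorphic_of_omega_categorical S T cS.
by split; split=> // h; [apply/oc/wo|apply/ow/co].
Qed.
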